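(* Fix $p\in(0,1)$ and $\beta>8$. For each $n$, let the communication graph be a single directed Erdős–Rényi random graph $G(n,p)$ on $n$ nodes, used in every round, and let all nodes run Algorithm RLNC($\beta$). Let $T^{\rm all}_n$ be the smallest $r$ such that, for every node $v$, the coefficient vectors available to $v$ after round $r$ span $\mathbb F_2^n$. Then $$\lim_{n\to\infty}\mathbb P\Bigl(T^{\rm all}_n>\lceil 1/p\rceil+2\Bigr)=0.$$
   Context: A directed Erdős–Rényi random graph $G(n,p)$ has each ordered pair $(u,v)$, $u\ne v$, present independently with probability $p$; a broadcast by $u$ in any round is received by exactly the nodes $v$ with $(u,v)$ an edge. Nodes are identified with $\{1,\dots,n\}$; $N^{\rm in}_v$ is the set of in-neighbours of $v$ and $d^{\rm in}_v=|N^{\rm in}_v|$. Algorithm RLNC($\beta$): in round 1 each node broadcasts its own packet, so node $v$ obtains the packets of all $u\in N^{\rm in}_v$. In each round $t\ge2$, each node $v$ broadcasts the $\mathbb F_2$-linear combination $\sum_w X_{vw}(t)\,(\text{packet of }w)$ together with its coefficient vector $X_v(t)=(X_{vw}(t))_{w=1}^n\in\mathbb F_2^n$, where all $X_{vw}(t)$ are mutually independent (and independent of the graph given degrees), $X_{vw}(t)=0$ if $w\notin N^{\rm in}_v$, and $\mathbb P(X_{vw}(t)=1)=\pi_v:=\min\{1,\beta\log(d^{\rm in}_v)/d^{\rm in}_v\}$ if $w\in N^{\rm in}_v$ (with $\pi_v=0$ if $d^{\rm in}_v\le1$). The coefficient vectors available to $v$ after round $r$ are: the unit vector $e_v$, the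 unit vectors $e_u$ for $u\in N^{\rm in}_v$, and $X_u(t)$ for all $u\in N^{\rm in}_v$ and $2\le t\le r$. Decoding all packets is possible exactly when these span $\mathbb F_2^n$. *)

(* Defs.v *)
From HB Require Import structures.
From mathcomp Require Import all_boot all_order all_algebra.
From mathcomp Require Import all_classical all_reals all_analysis.
Set Implicit Arguments. Unset Strict Implicit. Unset Printing Implicit Defensive.
Import Order.TTheory GRing.Theory Num.Theory.
Local Open Scope ring_scope.

(* A directed graph on nodes 'I_n: E (u, v) = true means the edge u -> v.
   Loops are given probability 0 by graph_weight. *)
Definition digraph (n : nat) := {ffun 'I_n * 'I_n -> bool}.

Definition in_nbr (n : nat) (E : digraph n) (v u : 'I_n) : bool :=
  (u != v) && E (u, v).

Definition indeg (n : nat) (E : digraph n) (v : 'I_n) : nat :=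
  #|[pred u : 'I_n | in_nbr E v u]|.

Definition pi_coef (R : realType) (beta : R) (d : nat) : R :=
  if (d <= 1)%N then 0 else Num.min 1 (beta * ln (d%:R) / d%:R).

Definition graph_weight (R : realType) (p : R) (n : nat) (E : digraph n) : R :=
  \prod_(e : 'I_n * 'I_n)
    (if e.1 == e.2 then (if E e then 0 else 1)
     else (if E e then p else 1 - p)).

(* Coefficients: X ((i, v), w) = X_{vw}(i+2), for rounds 2 .. K+1. *)
Definition coefs (K n : nat) := {ffun 'I_K * 'I_n * 'I_n -> bool}.

Definition coef_weight (R : realType) (beta : R) (K n : nat) (E : digraph n)
    (X : coefs K n) : R :=
  \prod_(k : 'I_K * 'I_n * 'I_n)
    (if in_nbr E k.1.2 k.2 then
       (if X k then pi_coef beta (indeg E k.1.2)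
        else 1 - pi_coef beta (indeg E k.1.2))
     else (if X k then 0 else 1)).

Definition unit_rv (n : nat) (u : 'I_n) : 'rV['F_2]_n := delta_mx 0 u.

Definition coef_rv (K n : nat) (X : coefs K n) (i : 'I_K) (u : 'I_n) : 'rV['F_2]_n :=
  \row_w (if X (i, u, w) then 1 else 0).

Definition avail_space (K n : nat) (E : digraph n) (X : coefs K n) (r : nat)
    (v : 'I_n) : 'M['F_2]_n :=
  (<<unit_rv v>> +
   \sum_(u | in_nbr E v u)
      (<<unit_rv u>> + \sum_(i : 'I_K | (i + 2 <= r)%N) <<coef_rv X i u>>))%MS.

Definition decodes (K n : nat) (E : digraph n) (X : coefs K n) (r : nat)
    (v : 'I_n) : bool :=
  row_full (avail_space E X r v).

Definition all_decode (K n : nat) (E : digraph n) (X : coefs K n) (r : nat) : bool :=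
  [forall v : 'I_n, decodes E X r v].

Definition round_bound (R : realType) (p : R) : nat :=
  (absz (Num.ceil p^-1) + 2)%N.

(* T^all_n > Rb  iff  no round r with 1 <= r <= Rb has all nodes decoding.
   Only rounds 2..Rb matter, so coefficients are sampled for K = Rb - 1 rounds. *)
Definition prob_late (R : realType) (p beta : R) (n : nat) : R :=
  let Rb := round_bound p in
  let K := (Rb - 1)%N in
  \sum_(E : digraph n) \sum_(X : coefs K n)
     (if [forall r : 'I_Rb.+1, (1 <= r)%N ==> ~~ all_decode E X r]
      then graph_weight p E * coef_weight beta E X else 0).

(* Main.v *)
(* A node [v] fails to decode iff some nonempty set [S] of nodes, the support of
   a vector orthogonal to everything available to [v], misses [v] and its
   in-neighbours and meets every received coefficient vector in an even number of
   ones.  Given the graph, a packet of an in-neighbour [u] passes this parity test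
   with probability [(1 + (1 - 2 pi_u)^j) / 2], where [j] counts the points of [S]
   among the in-neighbours of [u].  Off an event of exponentially small
   probability all in-degrees are within a factor [1 +- p/16] of [p n], so that
   [pi_u >= q] with [q] of order [ln n / n]; averaging over the columns of the
   graph, which are independent, then replaces [j] by a binomial variable whose
   generating function is explicit.  The union bound over [v] and [S] is split by
   [s = #|S|]:
   - if [q s <= 1/6], each factor is at most [exp(- 3/4 q j)] and [beta > 8] yields
     [n^(- 3 s)];
   - if [1/6 <= q s] and [s] is at most a small multiple of [n], each in-neighbour
     contributes a constant factor below [1], which beats the entropy of the
     choice of [S];
   - for larger [s] the packets are nearly unbiased, and there are
     [(K p) (1 - p/16) n] of them with [K p >= 1 + p], which beats [2^n]. *)
Require Import Defs.
From HB Require Import structures.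
From mathcomp Require Import all_boot all_order all_algebra.
From mathcomp Require Import all_classical all_reals all_analysis.
From mathcomp Require Import ring lra.
Set Implicit Arguments. Unset Strict Implicit. Unset Printing Implicit Defensive.
Import Order.TTheory GRing.Theory Num.Theory.
Local Open Scope ring_scope.

(** * Averages over the graph *)

Lemma sum_ffun_curry (R : comNzRingType) (I J T : finType)
    (H : I -> {ffun J -> T} -> R) :
  \sum_(X : {ffun I * J -> T}) \prod_i H i [ffun j => X (i, j)]
  = \prod_i \sum_x H i x.
Proof.
rewrite bigA_distr_bigA /=.
pose cur (X : {ffun I * J -> T}) : {ffun I -> {ffun J -> T}} :=
  [ffun i => [ffun j => X (i, j)]].
pose unc (Y : {ffun I -> {ffun J -> T}}) : {ffun I * J -> T} :=
  [ffun z => Y z.1 z.2].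
rewrite (reindex cur) /=; last first.
  exists unc => [X|Y] _; first by apply/ffunP => [[i j]]; rewrite !ffunE.
  by apply/ffunP => i; apply/ffunP => j; rewrite !ffunE.
by apply: eq_bigr => X _; apply: eq_bigr => i _; rewrite ffunE.
Qed.

Lemma sum_ffun_curry_swap (R : comNzRingType) (I J T : finType)
    (H : J -> {ffun I -> T} -> R) :
  \sum_(X : {ffun I * J -> T}) \prod_j H j [ffun i => X (i, j)]
  = \prod_j \sum_x H j x.
Proof.
rewrite -sum_ffun_curry.
pose sw (A B : finType) (X : {ffun A * B -> T}) : {ffun B * A -> T} :=
  [ffun z => X (z.2, z.1)].
rewrite (reindex (sw J I)) /=; last first.
  by exists (sw I J) => X _; apply/ffunP => [[i j]]; rewrite !ffunE.
apply: eq_bigr => X _; apply: eq_bigr => j _; congr (H j _).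
by apply/ffunP => i; rewrite !ffunE.
Qed.

Section Columns.
Variables (R : realType) (n : nat).
Implicit Types (p r : R) (u v : 'I_n) (S : {set 'I_n}) (E : digraph n).

(** Law of the edges into [v]; [graph_weight] is the product of these laws over [v]. *)
Definition col_weight p v (c : {ffun 'I_n -> bool}) : R :=
  \prod_u (if u == v then (if c u then 0 else 1) else (if c u then p else 1 - p)).

Definition in_nbrs E v : {set 'I_n} := [set u | in_nbr E v u].

Definition col_nbrs v (c : {ffun 'I_n -> bool}) : {set 'I_n} :=
  [set u | (u != v) && c u].

Definition in_col E v : {ffun 'I_n -> bool} := [ffun u => E (u, v)].

Lemma col_nbrsE E v : col_nbrs v (in_col E v) = in_nbrs E v.
Proof. by apply/setP => u; rewrite !inE ffunE. Qed.

Lemma indegE E v : indeg E v = #|in_nbrs E v|.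
Proof. by rewrite /in_nbrs cardsE. Qed.

(** Distinct nodes receive along disjoint sets of edges, so their columns are independent. *)
Lemma graph_expectation p (f : 'I_n -> {ffun 'I_n -> bool} -> R) :
  \sum_(E : digraph n) graph_weight p E * \prod_u f u (in_col E u)
  = \prod_u \sum_c col_weight p u c * f u c.
Proof.
rewrite -sum_ffun_curry_swap; apply: eq_bigr => E _.
rewrite big_split /=; congr (_ * _).
rewrite /graph_weight (eq_bigr (fun e => (fun u v => if u == v then if E (u, v) then 0 else 1
  else if E (u, v) then p else 1 - p) e.1 e.2)); last by case.
rewrite -(pair_bigA _ (fun u v => if u == v then if E (u, v) then 0 else 1
  else if E (u, v) then p else 1 - p)) exchange_big /=.
by apply: eq_bigr => v _; apply: eq_bigr => u _; rewrite ffunE.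
Qed.

Lemma graph_expectation1 p v (f : {ffun 'I_n -> bool} -> R) :
  (forall u, \sum_c col_weight p u c = 1) ->
  \sum_(E : digraph n) graph_weight p E * f (in_col E v)
  = \sum_c col_weight p v c * f c.
Proof.
move=> w1; have := graph_expectation p (fun u c => if u == v then f c else 1).
rewrite [RHS](bigD1 v) //= eqxx [X in _ * X]big1 ?mulr1 => [|u /negPf ->]; last first.
  by under eq_bigr do rewrite mulr1.
move=> <-; apply: eq_bigr => E _; congr (_ * _).
by rewrite (bigD1 v) //= eqxx big1 ?mulr1 // => u /negPf ->.
Qed.

Lemma prodr_if_card (T : finType) (A : {set T}) r :
  \prod_(i : T) (if i \in A then r else 1) = r ^+ #|A|.
Proof. by rewrite -big_mkcond prodr_const. Qed.

(** Binomial generating function; [v] leaves the exponent because loops have probability [0]. *)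
Lemma col_mgf p r v S :
  \sum_c col_weight p v c * r ^+ #|S :&: col_nbrs v c|
  = (1 - p + p * r) ^+ #|S :\ v|.
Proof.
rewrite -prodr_if_card.
pose F u (b : bool) : R := (if u == v then (if b then 0 else 1) else
   if b then p else 1 - p) * (if (u \in S) && ((u != v) && b) then r else 1).
transitivity (\sum_(c : {ffun 'I_n -> bool}) \prod_u F u (c u)).
  apply: eq_bigr => c _; rewrite -prodr_if_card -big_split /=.
  by apply: eq_bigr => u _; rewrite /F !inE.
rewrite -(bigA_distr_bigA F); apply: eq_bigr => u _.
rewrite big_bool /F !inE /=; case: eqVneq => _ /=; first by rewrite andbF; ring.
by rewrite andbT andbF; case: (u \in S); ring.
Qed.

Lemma sum_col_weight p v : \sum_c col_weight p v c = 1.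
Proof.
by have := col_mgf p 1 v finset.set0; rewrite finset.set0D cards0 expr0 => <-;
  apply: eq_bigr => c _; rewrite expr1n mulr1.
Qed.

Lemma col_weight_ge0 p v c : 0 <= p <= 1 -> 0 <= col_weight p v c.
Proof.
move=> /andP[p0 p1]; apply: prodr_ge0 => u _.
by case: ifP => _; case: ifP => _ //; rewrite subr_ge0.
Qed.

Lemma graph_weight_ge0 p E : 0 <= p <= 1 -> 0 <= graph_weight p E.
Proof.
move=> /andP[p0 p1]; apply: prodr_ge0 => u _.
by case: ifP => _; case: ifP => _ //; rewrite subr_ge0.
Qed.

Lemma indeg_mgf p r v :
  \sum_(E : digraph n) graph_weight p E * r ^+ indeg E v
  = (1 - p + p * r) ^+ n.-1.
Proof.
have := col_mgf p r v finset.setT; rewrite finset.setTD cardsC1 card_ord => <-.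
rewrite -(graph_expectation1 (p := p) v (fun c => r ^+ #|finset.setT :&: col_nbrs v c|)); last first.
  by move=> u; exact: sum_col_weight.
by apply: eq_bigr => E _; rewrite finset.setTI col_nbrsE indegE.
Qed.

(* Given the in-neighbourhood of [v], the in-neighbourhoods of the other nodes
   are still independent; condition on the column of [v]. *)
Lemma graph_avg_bound p v S (A B r : R) (P : pred nat) (D : R) :
  0 <= p <= 1 ->
  let M := A + B * (1 - p + p * r) ^+ #|S| in
  (forall d, P d -> M ^+ d <= D) -> 0 <= D ->
  \sum_(E : digraph n) graph_weight p E *
     (if P (indeg E v) && [disjoint S & in_nbrs E v]
      then \prod_(u in in_nbrs E v) (A + B * r ^+ #|S :&: in_nbrs E u|) else 0)
  <= D.
Proof.
move=> p01 M MD D0.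
pose ok c := P #|col_nbrs v c| && [disjoint S & col_nbrs v c].
(* The factor at [v] is the indicator that its column equals [c]. Summing over [c] recovers the
   integrand, while for fixed [c] the product runs over a fixed set of nodes. *)
pose f (c : {ffun 'I_n -> bool}) u (e : {ffun 'I_n -> bool}) : R :=
  if u == v then (if e == c then (if ok c then 1 else 0) else 0)
  else if u \in col_nbrs v c then A + B * r ^+ #|S :&: col_nbrs u e| else 1.
have -> : \sum_(E : digraph n) graph_weight p E *
     (if P (indeg E v) && [disjoint S & in_nbrs E v]
      then \prod_(u in in_nbrs E v) (A + B * r ^+ #|S :&: in_nbrs E u|) else 0)
  = \sum_(E : digraph n) \sum_c graph_weight p E * \prod_u f c u (in_col E u).
  apply: eq_bigr => E _; rewrite (bigD1 (in_col E v)) //= [X in _ + X]big1 ?addr0; last first.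
    move=> c cE; rewrite (bigD1 v) //= {1}/f eqxx eq_sym (negPf cE) mul0r mulr0 //.
  congr (_ * _); rewrite [RHS](bigD1 v) //= {1}/f !eqxx /ok col_nbrsE -indegE.
  case: ifP => _; rewrite ?mul0r // mul1r.
  rewrite big_mkcond [in LHS](bigD1 v) //= inE /in_nbr eqxx /= mul1r.
  by apply: eq_bigr => u /negPf uv; rewrite /f uv col_nbrsE col_nbrsE.
rewrite exchange_big /=.
under eq_bigr do rewrite graph_expectation.
apply: (@le_trans _ _ (\sum_c col_weight p v c * D)); last first.
  by rewrite -mulr_suml sum_col_weight mul1r.
apply: ler_sum => c _; rewrite (bigD1 v) //=.
rewrite (bigD1 c) //= {1}/f !eqxx [X in _ + X]big1 ?addr0; last first.
  by move=> e /negPf ec; rewrite /f eqxx ec mulr0.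
case okc: (ok c); last by rewrite mulr0 mul0r mulr_ge0 // col_weight_ge0.
rewrite mulr1 ler_wpM2l ?col_weight_ge0 //.
move: okc => /andP[Pc dis].
apply: le_trans (MD _ Pc).
rewrite -prodr_if_card [leRHS](bigD1 v) //= inE eqxx /= mul1r.
rewrite le_eqVlt; apply/orP; left; apply/eqP; apply: eq_bigr => u /negPf uv.
rewrite /f uv; case: ifP => uc; last by under eq_bigr do rewrite mulr1; rewrite sum_col_weight.
under eq_bigr do rewrite mulrDr; rewrite big_split /= -mulr_suml sum_col_weight mul1r.
congr (_ + _); under eq_bigr do rewrite mulrCA.
rewrite -mulr_sumr col_mgf; congr (_ * _ ^+ _).
(* An in-neighbour [u] of [v] lies outside [S], so removing it leaves the exponent [#|S|]. *)
have uS : u \notin S by apply: contraL uc => uS; rewrite (disjointFr dis uS).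
by apply: eq_card => w; rewrite !inE; case: eqVneq => // ->; rewrite (negPf uS).
Qed.

End Columns.

(** * Parity tests on the coefficient vectors *)

Definition even_on (T : finType) (S : {set T}) (x : {ffun T -> bool}) : bool :=
  ~~ odd #|S :&: [set w | x w]|.

(* [S] is the support of a vector orthogonal to everything available to [v]. *)
Definition blocked (K n : nat) (E : digraph n) (X : coefs K n) (v : 'I_n)
    (S : {set 'I_n}) : bool :=
  [&& v \notin S, [disjoint S & in_nbrs E v] &
    [forall i : 'I_K, [forall u in in_nbrs E v, even_on S [ffun w => X (i, u, w)]]]].

Lemma F2_natr_eq0 m : (m%:R == 0 :> 'F_2) = ~~ odd m.
Proof. by rewrite -(dvdn_pcharf (pchar_Fp (isT : prime 2))) dvdn2. Qed.

Lemma F2_neq0 (x : 'F_2) : x != 0 -> x = 1.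
Proof. by case: x => [[|[|m]] Hm] // _; apply/val_inj. Qed.

(** When the rank is deficient, the cokernel matrix has a nonzero column. It is orthogonal to
    everything available, and over ['F_2] it is determined by its support, which serves as [S]. *)
Lemma not_decodes_blocked (K n : nat) (E : digraph n) (X : coefs K n) r v :
  (forall i : 'I_K, (i + 2 <= r)%N) -> ~~ decodes E X r v ->
  exists2 S : {set 'I_n}, S != finset.set0 & blocked E X v S.
Proof.
move=> Kr nd; set A := avail_space E X r v in nd.
have : cokermx A != 0.
  rewrite -mxrank_eq0 mxrank_coker subn_eq0 -ltnNge ltn_neqAle rank_leq_row andbT.
  exact: nd.
case/matrix0Pn => i0 [j yj]; pose y := \col_i cokermx A i j.
have Ay (z : 'rV_n) : (z <= A)%MS -> z *m y = 0.
  case/submxP => D ->; rewrite -mulmxA; apply/matrixP => a b.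
  have /matrixP coker0 := mulmx_coker A.
  rewrite !mxE big1 // => k _; rewrite [X in _ * X](_ : _ = 0) ?mulr0 //.
  have := coker0 k j; rewrite !mxE => c0; rewrite -[RHS]c0.
  by apply: eq_bigr => l _; rewrite !mxE.
have yE i : y i 0 = (y i 0 != 0)%:R by case: eqP => // /eqP /F2_neq0.
have unitA u : (unit_rv u <= A)%MS -> y u 0 = 0.
  by move/Ay/matrixP/(_ 0 0); rewrite -rowE !mxE.
exists [set w | y w 0 != 0]; first by apply/set0Pn; exists i0; rewrite inE mxE.
have subA u (z : 'rV_n) : in_nbr E v u ->
   (z <= <<unit_rv u>> + \sum_(i : 'I_K | (i + 2 <= r)%N) <<coef_rv X i u>>)%MS -> (z <= A)%MS.
  move=> vu zu; apply: submx_trans zu _.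
  by rewrite /A /avail_space; apply: submx_trans (addsmxSr _ _); exact: (sumsmx_sup u).
apply/and3P; split.
- by rewrite inE negbK unitA // -genmxE addsmxSl.
- rewrite disjoint_sym disjoint_subset; apply/fintype.subsetP => u.
  by rewrite !inE negbK => vu; rewrite unitA //; apply: subA vu _; rewrite -genmxE addsmxSl.
- apply/forallP => i; apply/forall_inP => u; rewrite inE => vu.
  rewrite /even_on -F2_natr_eq0; apply/eqP.
  have /Ay/matrixP/(_ 0 0) : (coef_rv X i u <= A)%MS.
    apply: subA vu _; apply: submx_trans (addsmxSr _ _).
    by apply: (sumsmx_sup i) => //; rewrite genmxE.
  rewrite mxE [RHS]mxE => sum0; rewrite -[RHS]sum0.
  rewrite -sum1_card natr_sum big_mkcond /=; apply: eq_bigr => w _.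
  have -> : coef_rv X i u 0 w = (X (i, u, w))%:R by rewrite mxE; case: (X _).
  by rewrite !inE ffunE [in RHS]yE -natrM mulnb andbC; case: (_ && _).
Qed.

Section Coding.
Variables (R : realType) (beta : R) (K n : nat).
Implicit Types (E : digraph n) (X : coefs K n) (v u : 'I_n) (S : {set 'I_n}).

(** The indicator of even parity is the mean of [1] and a sign that factors over the coordinates. *)
Lemma even_on_prob (T : finType) (S A : {set T}) (q : R) :
  \sum_(x : {ffun T -> bool})
     (\prod_w (if w \in A then (if x w then q else 1 - q)
               else (if x w then 0 else 1))) * (even_on S x)%:R
  = (1 + (1 - 2 * q) ^+ #|S :&: A|) / 2.
Proof.
pose F (s : R) w (b : bool) : R := (if w \in A then (if b then q else 1 - q)
   else (if b then 0 else 1)) * (if (w \in S) && b then s else 1).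
have FE s : \sum_(x : {ffun T -> bool}) \prod_w F s w (x w)
    = (1 - q + s * q) ^+ #|S :&: A|.
  rewrite -(bigA_distr_bigA (F s)) -prodr_if_card; apply: eq_bigr => w _.
  by rewrite big_bool /F inE /=; case: (w \in A); case: (w \in S) => /=; ring.
transitivity (((1 - q + 1 * q) ^+ #|S :&: A| + (1 - q + -1 * q) ^+ #|S :&: A|) / 2);
  last first.
  by rewrite mul1r subrK expr1n; congr ((1 + _ ^+ _) / _); ring.
rewrite -!FE -big_split /= mulr_suml; apply: eq_bigr => x _.
rewrite /F !big_split /= -mulrDr -mulrA; congr (_ * _).
rewrite /even_on big1 => [|w _]; last by case: ifP.
have -> : \prod_i (if (i \in S) && x i then -1 else 1) = (-1) ^+ #|S :&: [set w | x w]| :> R.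
  by rewrite -prodr_if_card; apply: eq_bigr => w _; rewrite !inE.
by rewrite -signr_odd; case: odd => /=; field.
Qed.

(** Given the graph the packets are independent, and the [K] packets of one sender have the same
    pass probability. *)
Lemma blocked_prob E v S : v \notin S -> [disjoint S & in_nbrs E v] ->
  \sum_(X : coefs K n) coef_weight beta E X * (blocked E X v S)%:R
  = \prod_(u in in_nbrs E v)
      ((1 + (1 - 2 * pi_coef beta (indeg E u)) ^+ #|S :&: in_nbrs E u|) / 2) ^+ K.
Proof.
move=> vS dis.
pose H (k : 'I_K * 'I_n) (x : {ffun 'I_n -> bool}) : R :=
  (\prod_w (if w \in in_nbrs E k.2 then (if x w then pi_coef beta (indeg E k.2)
              else 1 - pi_coef beta (indeg E k.2)) else (if x w then 0 else 1)))
  * (if k.2 \in in_nbrs E v then (even_on S x)%:R else 1).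
transitivity (\sum_(X : coefs K n) \prod_k H k [ffun w => X (k, w)]).
  apply: eq_bigr => X _; rewrite /H big_split /=; congr (_ * _).
    rewrite pair_bigA /=; apply: eq_bigr => -[k w] _ /=.
    by rewrite inE ffunE.
  rewrite /blocked vS dis /=.
  have [/forallP all|] := boolP [forall i : 'I_K,
    [forall u in in_nbrs E v, even_on S [ffun w => X (i, u, w)]]].
    rewrite big1 // => -[i u] _ /=; case: ifP => // uv.
    by rewrite (forall_inP (all i)).
  rewrite negb_forall => /existsP[i]; rewrite negb_forall => /existsP[u].
  rewrite negb_imply => /andP[uv no].
  by rewrite (bigD1 (i, u)) //= uv (negPf no) mul0r.
rewrite sum_ffun_curry.
rewrite -(pair_bigA _ (fun i u => \sum_x H (i, u) x)) /= exchange_big /=.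
rewrite [RHS]big_mkcond; apply: eq_bigr => u _.
rewrite /H /= prodr_const card_ord; case: ifP => uv; first by rewrite even_on_prob.
(* A sender outside the in-neighbourhood is not tested: its factor is the total mass, computed as
   the parity probability for the empty set. *)
rewrite -[RHS](expr1n _ K); congr (_ ^+ _).
transitivity ((1 + (1 - 2 * pi_coef beta (indeg E u)) ^+ #|finset.set0 :&: in_nbrs E u|) / 2).
  by rewrite -even_on_prob; apply: eq_bigr => x _; rewrite /even_on finset.set0I cards0.
by rewrite finset.set0I cards0 expr0 divff // paddr_eq0 // oner_eq0.
Qed.

Lemma pi_coef_01 d : 0 <= beta -> 0 <= pi_coef beta d <= 1.
Proof.
move=> b0; rewrite /pi_coef; case: ifP => [_|/negbT d1]; first by rewrite lexx ler01.
rewrite ge_min lexx /= andbT le_min ler01 /=.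
rewrite divr_ge0 // mulr_ge0 // ln_ge0 // ler1n; by rewrite -ltnNge in d1; exact: ltnW.
Qed.

Lemma coef_weight_ge0 E X : 0 <= beta -> 0 <= coef_weight beta E X.
Proof.
move=> b0; apply: prodr_ge0 => k _; have /andP[? ?] := pi_coef_01 (indeg E k.1.2) b0.
by case: ifP => _; case: ifP => _ //; rewrite subr_ge0.
Qed.

Lemma sum_coef_weight E : \sum_(X : coefs K n) coef_weight beta E X = 1.
Proof.
pose F (k : 'I_K * 'I_n * 'I_n) (b : bool) : R :=
  if in_nbr E k.1.2 k.2 then (if b then pi_coef beta (indeg E k.1.2)
   else 1 - pi_coef beta (indeg E k.1.2)) else (if b then 0 else 1).
rewrite -[LHS]/(\sum_(X : coefs K n) \prod_k F k (X k)).
rewrite -(bigA_distr_bigA F) big1 // => k _; rewrite big_bool /F /=.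
by case: in_nbr; rewrite ?add0r // addrC subrK.
Qed.

End Coding.

(** * Union bound and concentration of the in-degrees *)

(** The form [A + B * r ^+ j] is one whose average over columns is explicit; the choice of [A], [B]
    and [r] depends on the size of [S]. The condition [P] on the senders gives the pointwise
    majorant, after which only [P] at [v] is kept. *)
Lemma blocked_avg_bound (R : realType) (p beta : R) (K n : nat) (v : 'I_n)
    (S : {set 'I_n}) (P : pred nat) (A B r D : R) :
  0 <= p <= 1 -> 0 <= A -> 0 <= B -> 0 <= r ->
  (forall d j, P d -> (j <= #|S|)%N ->
    0 <= 1 + (1 - 2 * pi_coef beta d) ^+ j /\
    ((1 + (1 - 2 * pi_coef beta d) ^+ j) / 2) ^+ K <= A + B * r ^+ j) ->
  (forall d, P d -> (A + B * (1 - p + p * r) ^+ #|S|) ^+ d <= D) -> 0 <= D ->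
  \sum_(E : digraph n) \sum_(X : coefs K n)
     graph_weight p E * coef_weight beta E X *
     (if [forall u, P (indeg E u)] then (blocked E X v S)%:R else 0) <= D.
Proof.
move=> p01 A0 B0 r0 Pj PD D0.
apply: le_trans (graph_avg_bound v p01 PD D0).
apply: ler_sum => E _; have W0 := graph_weight_ge0 E p01.
under [leLHS]eq_bigr => X _ do rewrite -mulrA.
rewrite -mulr_sumr ler_wpM2l //.
have F0 u : 0 <= A + B * r ^+ #|S :&: in_nbrs E u|.
  by rewrite addr_ge0 // mulr_ge0 // exprn_ge0.
case: (boolP [forall u, P (indeg E u)]) => [/forallP good|_]; last first.
  rewrite big1 => [|X _]; last by rewrite mulr0.
  by case: ifP => // _; exact: prodr_ge0.
rewrite good /=; have [dis|ndis] := boolP [disjoint S & in_nbrs E v]; last first.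
  by rewrite big1 // => X _; rewrite /blocked (negPf ndis) andbF mulr0.
have [vS|vS] := boolP (v \in S).
  rewrite big1 ?prodr_ge0 // => X _; by rewrite /blocked vS mulr0.
rewrite blocked_prob //; apply: ler_prod => u _.
have [h0 h1] := Pj _ #|S :&: in_nbrs E u| (good u) (subset_leq_card (finset.subsetIl _ _)).
by rewrite h1 exprn_ge0 ?divr_ge0.
Qed.

(** Union bound: lateness forces an in-degree violating [P] or, in the last allowed round, a node
    blocked by some nonempty [S]. *)
Lemma prob_late_le (R : realType) (p beta : R) (n : nat) (P : pred nat)
    (D : {set 'I_n} -> R) :
  0 <= p <= 1 -> 0 <= beta ->
  (forall S v, S != finset.set0 ->
    \sum_(E : digraph n) \sum_(X : coefs (round_bound p - 1) n)
     graph_weight p E * coef_weight beta E X *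
     (if [forall u, P (indeg E u)] then (blocked E X v S)%:R else 0) <= D S) ->
  prob_late p beta n <=
  \sum_(v : 'I_n) \sum_(E : digraph n) graph_weight p E * (~~ P (indeg E v))%:R
  + n%:R * \sum_(S : {set 'I_n} | S != finset.set0) D S.
Proof.
move=> p01 b0 HD.
pose good E := [forall u : 'I_n, P (indeg E u)].
apply: (@le_trans _ _ (\sum_(E : digraph n) \sum_(X : coefs (round_bound p - 1) n)
   (graph_weight p E * coef_weight beta E X * \sum_v (~~ P (indeg E v))%:R +
    \sum_v \sum_(S : {set 'I_n} | S != finset.set0)
     graph_weight p E * coef_weight beta E X *
     (if good E then (blocked E X v S)%:R else 0)))).
  rewrite /prob_late; apply: ler_sum => E _; apply: ler_sum => X _.
  have W0 : 0 <= graph_weight p E * coef_weight beta E X.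
    by apply: mulr_ge0; [exact: graph_weight_ge0 | exact: coef_weight_ge0].
  have I0 v S : 0 <= graph_weight p E * coef_weight beta E X *
     (if good E then (blocked E X v S)%:R else 0).
    by rewrite mulr_ge0 //; case: ifP.
  case: ifP => [late|_]; last first.
    apply: addr_ge0; first by apply: mulr_ge0 => //; exact: sumr_ge0.
    by apply: sumr_ge0 => v _; exact: sumr_ge0.
  case gE: (good E); last first.
    move/negbT: gE; rewrite negb_forall => /existsP[v Pv].
    apply: ler_wpDr; first by apply: sumr_ge0 => w _; apply: sumr_ge0 => S _; rewrite mulr0.
    apply: ler_peMr => //; rewrite (bigD1 v) //= Pv.
    by apply: ler_wpDr => //; exact: sumr_ge0.
  have Rb1 : (1 <= round_bound p)%N by rewrite /round_bound addn2.
  have := implyP (forallP late ord_max) Rb1; rewrite negb_forall.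
  case/existsP => v /not_decodes_blocked[|S S0 bS].
    (* Indices stay below [round_bound p - 1], so every sampled packet has arrived by the last
       round. *)
    by move=> i; have := ltn_ord i; rewrite ltn_subRL add1n addn2.
  apply: ler_wpDl; first by apply: mulr_ge0 => //; exact: sumr_ge0.
  rewrite (bigD1 v) //= (bigD1 S) //= bS mulr1 -addrA; apply: ler_wpDr => //.
  apply: addr_ge0; apply: sumr_ge0 => w _; first exact: mulr_ge0.
  by apply: sumr_ge0 => T _; exact: mulr_ge0.
under eq_bigr do rewrite big_split /=.
rewrite big_split /=; apply: lerD.
  rewrite exchange_big /= le_eqVlt; apply/orP; left; apply/eqP.
  rewrite exchange_big [RHS]exchange_big /=; apply: eq_bigr => E _.
  under eq_bigr do rewrite mulrAC.
  by rewrite -mulr_sumr sum_coef_weight mulr1 mulr_sumr.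
under eq_bigr do rewrite exchange_big /=.
rewrite exchange_big /= -[n in n%:R](card_ord n) -sum1_card natr_sum mulr_suml.
apply: ler_sum => v _; rewrite mul1r.
under eq_bigr do rewrite exchange_big /=.
by rewrite exchange_big /=; apply: ler_sum => S S0; exact: HD.
Qed.

Section Chernoff.
Variables (R : realType) (p : R) (n : nat) (v : 'I_n).
Hypothesis p01 : 0 <= p <= 1.

(** Exponential Markov inequality for a binomial variable with [n - 1] trials; the sign of [x]
    selects the tail. *)
Lemma indeg_exp_markov (Q : pred nat) (x a : R) :
  (forall d, Q d -> a <= x * d%:R) ->
  \sum_(E : digraph n) graph_weight p E * (Q (indeg E v))%:R
  <= expR (- a + p * (expR x - 1) * n.-1%:R).
Proof.
move=> Qa; rewrite expRD expRM_natr.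
apply: (@le_trans _ _ (expR (- a) * (1 - p + p * expR x) ^+ n.-1)).
  rewrite -(indeg_mgf p (expR x) v) mulr_sumr; apply: ler_sum => E _.
  rewrite mulrCA ler_wpM2l ?graph_weight_ge0 // -expRM_natr -expRD.
  case QE: (Q _) => /=; last exact: expR_ge0.
  rewrite -[leLHS]expR0 ler_expR; have := Qa _ QE; lra.
rewrite ler_wpM2l ?expR_ge0 // lerXn2r ?nnegrE ?expR_ge0 //.
  have := expR_ge0 x; move: p01 => /andP[? ?]; nra.
apply: le_trans (expR_ge1Dx _); lra.
Qed.

(** This follows from [expR x >= 1 + x] and [(1 + x) * (1 - x + x ^+ 2) = 1 + x ^+ 3]. *)
Lemma expRN_le (x : R) : 0 <= x -> expR (- x) <= 1 - x + x ^+ 2.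
Proof.
move=> x0; rewrite expRN; have e1 := expR_ge1Dx x.
have e0 : 0 < expR x by exact: expR_gt0.
rewrite -[leLHS]mul1r ler_pdivrMr //.
have : 0 <= 1 - x + x ^+ 2 by nra.
nra.
Qed.

(** Since [(1 - x) * expR x <= 1], it suffices that [(1 - x) * (1 + x + 2 * x ^+ 2) = 1 + x ^+ 2 *
    (1 - 2 * x)] is at least [1]. *)
Lemma expR_le_quad (x : R) : 0 <= x <= 2^-1 -> expR x <= 1 + x + 2 * x ^+ 2.
Proof.
move=> /andP[x0 x1]; have := expR_ge1Dx (- x); rewrite expRN.
have e0 : 0 < expR x by exact: expR_gt0.
move=> h; have h1 : (1 - x) * expR x <= 1 by rewrite -ler_pdivlMr // mul1r.
have : (1 - x) * expR x <= (1 - x) * (1 + x + 2 * x ^+ 2) by nra.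
rewrite ler_pM2l //; lra.
Qed.

(** Exponential Markov with [x = - (eps / 2)] for the lower tail and [x = eps / 4] for the upper
    one. The mean is [p * (n - 1)] but the window is centred at [p * n]; the factor [expR 1] absorbs
    the resulting loss in the lower tail. *)
Lemma indeg_concentration (eps : R) : 0 <= eps <= 1 -> 
  \sum_(E : digraph n) graph_weight p E *
    (~~ ((1 - eps) * p * n%:R <= (indeg E v)%:R <= (1 + eps) * p * n%:R))%:R
  <= (expR 1 + 1) * expR (- (p * eps ^+ 2 / 8) * n%:R).
Proof.
move=> /andP[e0 e1]; move: (p01) => /andP[p0 p1].
have n1 : n%:R = n.-1%:R + 1 :> R by rewrite natr1 prednK // (leq_ltn_trans _ (ltn_ord v)).
have m0 : 0 <= n.-1%:R :> R by [].
pose lo : pred nat := fun d => d%:R < (1 - eps) * p * n%:R.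
pose hi : pred nat := fun d => (1 + eps) * p * n%:R < d%:R.
apply: (@le_trans _ _ (\sum_(E : digraph n) graph_weight p E * (lo (indeg E v))%:R +
   \sum_(E : digraph n) graph_weight p E * (hi (indeg E v))%:R)).
  rewrite -big_split /=; apply: ler_sum => E _; rewrite -mulrDr ler_wpM2l ?graph_weight_ge0 //.
  rewrite -natrD ler_nat negb_and -!ltNge /lo /hi.
  by case: (_ < _); case: (_ < _).
rewrite mulrDl mul1r -expRD; apply: lerD.
  apply: le_trans (indeg_exp_markov (x := - (eps / 2)) (a := - (eps / 2) * ((1 - eps) * p * n%:R)) _) _.
    by move=> d /ltW; rewrite /lo => h; rewrite ler_wnM2l //; lra.
  rewrite ler_expR; have : expR (- (eps / 2)) <= 1 - eps / 2 + (eps / 2) ^+ 2.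
    by apply: expRN_le; lra.
  set z := expR _ => zl; rewrite n1; set m := n.-1%:R.
  have : p * m * (z - 1) <= p * m * (- (eps / 2) + (eps / 2) ^+ 2).
    by rewrite ler_wpM2l ?mulr_ge0 //; lra.
  have pm0 : 0 <= p * m by rewrite mulr_ge0.
  have := mulr_ge0 pm0 (sqr_ge0 eps).
  have : p * (eps * (1 - eps)) <= 1 by nra.
  have : p * eps ^+ 2 <= 1 by nra.
  nra.
apply: le_trans (indeg_exp_markov (x := eps / 4) (a := eps / 4 * ((1 + eps) * p * n%:R)) _) _.
  by move=> d /ltW; rewrite /hi => h; rewrite ler_wpM2l //; lra.
rewrite ler_expR; have : expR (eps / 4) <= 1 + eps / 4 + 2 * (eps / 4) ^+ 2.
  by apply: expR_le_quad; lra.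
set z := expR _ => zl; rewrite n1; set m := n.-1%:R.
have : p * m * (z - 1) <= p * m * (eps / 4 + 2 * (eps / 4) ^+ 2).
  by rewrite ler_wpM2l ?mulr_ge0 //; lra.
have pm0 : 0 <= p * m by rewrite mulr_ge0.
have := mulr_ge0 pm0 (sqr_ge0 eps).
have := mulr_ge0 p0 e0.
have := mulr_ge0 p0 (sqr_ge0 eps).
nra.
Qed.

End Chernoff.

(** * Elementary inequalities and asymptotics *)

(** The right-hand side is the chord over [[0, 1]] of a convex function of [y]. *)
Lemma half_chord (R : realType) (y : R) (K : nat) : 0 <= y <= 1 ->
  ((1 + y) / 2) ^+ K <= 2^-1 ^+ K + (1 - 2^-1 ^+ K) * y.
Proof.
move=> /andP[y0 y1]; elim: K => [|K IH]; first by rewrite !expr0 subrr mul0r addr0.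
rewrite !exprS; set c := 2^-1 ^+ K in IH *.
have /andP[c0 c1] : 0 <= c <= 1.
  by rewrite exprn_ge0 ?invr_ge0 // exprn_ile1 ?invr_ge0 // invf_le1 // ler1n.
apply: (@le_trans _ _ ((1 + y) / 2 * (c + (1 - c) * y))).
  by rewrite ler_wpM2l // divr_ge0 // addr_ge0.
have : 0 <= (1 - c) * (y * (1 - y)) by rewrite !mulr_ge0 // subr_ge0.
lra.
Qed.

(** From [expR (- (2 * y)) <= 1 / (1 + 2 * y)] the claim reduces to [3 * y ^+ 2 <= y / 2], which is
    where the cutoff [1 / 6] comes from. *)
Lemma half_exp_decay (R : realType) (y : R) : 0 <= y <= 6^-1 ->
  (1 + expR (- (2 * y))) / 2 <= expR (- (3 / 4 * y)).
Proof.
move=> /andP[y0 y1]; apply: le_trans (expR_ge1Dx _).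
have := expRN_le (x := 2 * y); have : 0 <= 2 * y by lra.
move=> h /(_ h); rewrite expRN; have e1 := expR_ge1Dx (2 * y).
have e0 := expR_gt0 (2 * y); set w := (expR _)^-1.
have : w * expR (2 * y) = 1 by rewrite /w mulVf // gt_eqF.
have w0 : 0 < w by rewrite invr_gt0.
move=> we _; have : w * (1 + 2 * y) <= 1 by rewrite -[leRHS]we ler_pM2l.
move=> h1; have : w <= 1 - 3 / 2 * y; last lra.
rewrite -(ler_pM2r (x := 1 + 2 * y)); nra.
Qed.

Lemma one_sub_exp (R : realType) (x : R) (j : nat) : 0 <= 1 - x ->
  (1 - x) ^+ j <= expR (- (x * j%:R)).
Proof.
move=> x1; rewrite -mulNr expRM_natr lerXn2r ?nnegrE ?expR_ge0 //.
exact: expR_ge1Dx.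
Qed.

Lemma near_ln_ge (R : realType) (C : R) :
  \forall n \near \oo%classic, C <= ln n%:R.
Proof.
near=> n.
have n0 : expR C <= n%:R by near: n; exact: nbhs_infty_ger.
by rewrite -[C]expRK ler_ln ?posrE ?expR_gt0 // (lt_le_trans (expR_gt0 C)).
Unshelve. all: by end_near. Qed.

Lemma expR_ge_sqr (R : realType) (x : R) : 0 <= x -> x ^+ 2 / 2 <= expR x.
Proof.
move=> x0; have := expR_ge1Dxn 1 x0; rewrite (_ : 2`!%:R = 2) //; lra.
Qed.

Lemma near_ln_le (R : realType) (c : R) : 0 < c ->
  \forall n \near \oo%classic, ln n%:R <= c * n%:R.
Proof.
move=> c0; near=> n.
have n1 : (0 < n)%N by near: n; exact: nbhs_infty_gt.
have n0 : 2 / c ^+ 2 <= n%:R by near: n; exact: nbhs_infty_ger.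
rewrite -[leRHS]expRK ler_ln ?posrE ?expR_gt0 ?ltr0n //.
apply: le_trans (expR_ge_sqr _); last by rewrite mulr_ge0 // ltW.
have c2 : 0 < c ^+ 2 by rewrite exprn_gt0.
move: n0; rewrite ler_pdivrMr // => n0; have : 0 < n%:R :> R by rewrite ltr0n.
rewrite exprMn; nra.
Unshelve. all: by end_near. Qed.

Lemma natmul_exp_le (R : realType) (c : R) (n : nat) : 0 < c -> (0 < n)%N ->
  n%:R * expR (- c * n%:R) <= 2 / c ^+ 2 / n%:R.
Proof.
move=> c0 n0; have N0 : 0 < n%:R :> R by rewrite ltr0n.
rewrite mulNr expRN ler_pdivrMr ?expR_gt0 //.
have e : n%:R = 2 / c ^+ 2 / n%:R * ((c * n%:R) ^+ 2 / 2).
  by field; rewrite !gt_eqF.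
rewrite [leLHS]e.
rewrite ler_wpM2l ?expR_ge_sqr ?mulr_ge0 ?invr_ge0 ?exprn_ge0 // ?ltW //.
Qed.

Lemma sum_pow_card (R : realType) (n : nat) (x : R) :
  \sum_(S : {set 'I_n}) x ^+ #|S| = (1 + x) ^+ n.
Proof.
have := bigA_distr (R := R) 1 (I := 'I_n) +%R (fun=> x) (fun=> 1).
rewrite prodr_const card_ord addrC => ->.
by apply: eq_big => [S|S _]; rewrite ?inE // prodr_if_card.
Qed.

(** Leaving out the empty set makes the bound of order [x * n] when [x * n] is small. *)
Lemma sum_pow_card_le (R : realType) (n : nat) (x : R) : 0 <= x ->
  \sum_(S : {set 'I_n} | S != finset.set0) x ^+ #|S| <= expR (x * n%:R) - 1.
Proof.
move=> x0; rewrite lerBrDr addrC.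
have -> : 1 + \sum_(S : {set 'I_n} | S != finset.set0) x ^+ #|S|
   = (1 + x) ^+ n.
  by rewrite -sum_pow_card [RHS](bigD1 finset.set0) //= cards0 expr0.
rewrite expRM_natr lerXn2r ?nnegrE ?expR_ge0 ?addr_ge0 //; exact: expR_ge1Dx.
Qed.

(** * The three ranges of support sizes *)

Section Rates.
Variables (R : realType) (p beta : R) (K : nat).
Hypotheses (p01 : 0 < p < 1) (beta8 : 8 < beta) (Kp : 1 + p <= K%:R * p).

Let eps : R := p / 16.
Let k0 : R := 15 * beta / (16 * (1 + eps) * p).
Let typical (n : nat) : pred nat :=
  fun d => (1 - eps) * p * n%:R <= d%:R <= (1 + eps) * p * n%:R.
(* Eventually at most [pi_coef beta d] for typical [d]; the factor [15 / 16] makes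
   room for [15 / 16 * ln n <= ln ((1 - eps) * p * n)]. *)
Let q (n : nat) : R := k0 * ln n%:R / n%:R.

Let p0 : 0 < p. Proof. by case/andP: p01. Qed.
Let p1 : p < 1. Proof. by case/andP: p01. Qed.
Let eps0 : 0 < eps. Proof. by rewrite divr_gt0. Qed.
Let eps1 : eps < 16^-1. Proof. rewrite /eps; have := p1; lra. Qed.
Let e10 : 0 < 1 - eps. Proof. have := eps1; lra. Qed.
Let k00 : 0 < k0.
Proof.
have b0 : 0 < beta by have := beta8; lra.
by rewrite /k0 divr_gt0 ?mulr_gt0 ?addr_gt0.
Qed.

Lemma q_ge0 n : 1 <= n%:R :> R -> 0 <= q n.
Proof. by move=> n1; exact: divr_ge0 (mulr_ge0 (ltW k00) (ln_ge0 n1)) (ler0n _ _). Qed.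

Lemma near_q_le (c : R) : 0 < c -> \forall n \near \oo%classic, q n <= c.
Proof.
move=> c0; near=> n.
have n1 : (0 < n)%N by near: n; exact: nbhs_infty_gt.
have h : ln n%:R <= c / k0 * n%:R by near: n; apply: near_ln_le; rewrite divr_gt0.
rewrite /q ler_pdivrMr ?ltr0n // -ler_pdivlMl //; apply: le_trans h _.
by rewrite mulrA [_^-1 * _]mulrC.
Unshelve. all: by end_near. Qed.

(** The upper bound keeps [1 - 2 * pi_coef beta d] nonnegative, so that its powers are monotone. *)
Lemma near_pi_coef_range : \forall n \near \oo%classic, forall d,
  typical n d -> q n <= pi_coef beta d <= 2^-1.
Proof.
have b0 : 0 < beta by have := beta8; lra.
have e1p : 0 < (1 - eps) * p by exact: mulr_gt0 e10 p0.
near=> n => d /andP[ad db].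
(* This forces [d >= 2], hence the logarithmic branch of [pi_coef]. *)
have n0 : 2 / ((1 - eps) * p) <= n%:R by near: n; exact: nbhs_infty_ger.
have l1 : - 16 * ln ((1 - eps) * p) <= ln n%:R by near: n; exact: near_ln_ge.
have l2 : ln n%:R <= (1 - eps) * p / (4 * beta) * n%:R.
  by near: n; apply: near_ln_le; rewrite divr_gt0 // mulr_gt0.
have n2 : 2 <= n%:R :> R by near: n; exact: nbhs_infty_ger.
have N0 : 0 < n%:R :> R by lra.
have d2 : 2 <= d%:R :> R.
  by apply: le_trans ad; rewrite mulrC -ler_pdivrMr.
have d0 : 0 < d%:R :> R by lra.
have d1 : (d <= 1)%N = false.
  by apply/negbTE; rewrite -ltnNge -(ler_nat R).
have bp : 0 < (1 + eps) * p by rewrite mulr_gt0 ?addr_gt0.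
have lnd : 15 / 16 * ln n%:R <= ln d%:R :> R.
  apply: (@le_trans _ _ (ln ((1 - eps) * p * n%:R))); last by rewrite ler_ln ?posrE // (mulr_gt0 e1p).
  by rewrite lnM ?posrE //; lra.
have lnd2 : ln d%:R <= 2 * ln n%:R :> R.
  have -> : 2 * ln n%:R = ln (n%:R * n%:R) :> R by rewrite lnM ?posrE //; ring.
  rewrite ler_ln ?posrE ?mulr_gt0 //; apply: le_trans db _; rewrite ler_pM2r //.
  by apply: le_trans n2; have := eps1; have := p1; have := p0; have := eps0; nra.
have l0 : 0 <= ln n%:R :> R by rewrite ln_ge0 //; lra.
have half : beta * ln d%:R / d%:R <= 2^-1.
  rewrite ler_pdivrMr //.
  apply: (@le_trans _ _ (beta * (2 * ((1 - eps) * p / (4 * beta) * n%:R)))).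
    by rewrite ler_pM2l //; lra.
  have -> : beta * (2 * ((1 - eps) * p / (4 * beta) * n%:R)) = 2^-1 * ((1 - eps) * p * n%:R).
    by field; rewrite gt_eqF.
  by rewrite ler_pM2l ?invr_gt0.
have low : q n <= beta * ln d%:R / d%:R.
  rewrite ler_pdivlMr //.
  apply: (@le_trans _ _ (q n * ((1 + eps) * p * n%:R))).
    by rewrite ler_wpM2l // q_ge0 //; lra.
  have -> : q n * ((1 + eps) * p * n%:R) = beta * (15 / 16 * ln n%:R).
    by rewrite /q /k0; field; rewrite !gt_eqF // addr_gt0.
  by rewrite ler_pM2l.
rewrite /pi_coef d1 le_min ge_min half orbT andbT low andbT.
by apply: le_trans low (le_trans half _); rewrite invf_le1 // ler1n.
Unshelve. all: by end_near. Qed.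

(** Here [c] is the chance that [K] unbiased packets all pass. In the medium range an in-neighbour
    contributes at most [1 - kap], where [p / 3] is the value of [2 * p * q * s] at [q * s = 1 / 6],
    and all of them together at most [expR (- c1 * n)]. *)
Let c : R := 2^-1 ^+ K.
Let kap : R := (1 - c) * (1 - expR (- (p / 3))).
Let c1 : R := kap * ((1 - eps) * p).
Let D (n s : nat) : R :=
  expR (- (3 * ln n%:R)) ^+ s + expR (- (c1 / 2) * n%:R) * (c1 / 4) ^+ s
  + expR (- (ln 2 * (1 + p / 2)) * n%:R).

Let K0 : (0 < K)%N.
Proof.
rewrite lt0n; apply/eqP => k; move: Kp; rewrite k mul0r; have := p0; lra.
Qed.

Let c01 : 0 < c <= 2^-1.
Proof.
rewrite /c exprn_gt0 ?invr_gt0 //= -(prednK K0) exprS ger_pMr ?invr_gt0 //.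
by rewrite exprn_ile1 ?invr_ge0 // invf_le1 // ler1n.
Qed.

Let kap0 : 0 < kap.
Proof.
rewrite mulr_gt0 ?subr_gt0 ?expR_lt1 ?oppr_lt0 ?divr_gt0 //.
by case/andP: c01 => _; lra.
Qed.

Let c10 : 0 < c1.
Proof. exact: mulr_gt0 kap0 (mulr_gt0 e10 p0). Qed.


Let T (n : nat) (v : 'I_n) (S : {set 'I_n}) : R :=
  \sum_(E : digraph n) \sum_(X : coefs K n)
     graph_weight p E * coef_weight beta E X *
     (if [forall u, typical n (indeg E u)] then (blocked E X v S)%:R else 0).

Let ratio n d : q n <= pi_coef beta d <= 2^-1 ->
  0 <= 1 - 2 * pi_coef beta d <= 1 - 2 * q n.
Proof. case/andP; lra. Qed.

(** With [A = 0] and [B = 1], each point of [S] costs a factor [1 - p * (1 - expR (- z))] per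
    in-neighbour of [v], which multiplies up to at most [n ^- 3]. *)
Lemma small_support : \forall n \near \oo%classic, forall (v : 'I_n) (S : {set 'I_n}),
  q n * #|S|%:R <= 6^-1 -> T v S <= expR (- (3 * ln n%:R)) ^+ #|S|.
Proof.
have b0 : 0 < beta by have := beta8; lra.
near=> n => v S qS.
have range : forall d, typical n d -> q n <= pi_coef beta d <= 2^-1.
  by near: n; exact: near_pi_coef_range.
have n2 : 2 <= n%:R :> R by near: n; exact: nbhs_infty_ger.
have N0 : 0 < n%:R :> R by lra.
have l0 : 0 <= ln n%:R :> R by rewrite ln_ge0 //; lra.
have q0 : 0 <= q n by rewrite q_ge0 //; lra.
have KR : 0 < K%:R :> R by rewrite ltr0n.
have qs : q n <= 16^-1 / K%:R by near: n; apply: near_q_le; rewrite divr_gt0 ?invr_gt0 ?ltr0n.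
pose z := 3 / 4 * q n * K%:R.
have z0 : 0 <= z by have := mulr_ge0 q0 (ltW KR); rewrite /z; lra.
have z1 : z <= 16^-1.
  by move: qs; rewrite ler_pdivlMr // /z; have := mulr_ge0 q0 (ltW KR); lra.
apply: (@blocked_avg_bound R p beta K n v S (typical n) 0 1 (expR (- z))) => //.
- by rewrite !ltW.
- move=> d j /range/ratio/andP[x0 x1] jS.
  set x := 1 - 2 * _ in x0 x1 *; split; first by rewrite addr_ge0 ?exprn_ge0.
  have jS' : j%:R <= #|S|%:R :> R by rewrite ler_nat.
  have xj : x ^+ j <= expR (- (2 * (q n * j%:R))).
    apply: (@le_trans _ _ ((1 - 2 * q n) ^+ j)); first by rewrite lerXn2r ?nnegrE //; lra.
    by rewrite mulrA; apply: one_sub_exp; lra.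
  rewrite add0r mul1r -expRM_natr (_ : - z * j%:R = - (3 / 4 * (q n * j%:R)) * K%:R); last first.
    by rewrite /z; ring.
  rewrite expRM_natr lerXn2r ?nnegrE ?expR_ge0 ?divr_ge0 ?addr_ge0 ?exprn_ge0 //.
  apply: le_trans (half_exp_decay _); first by rewrite ler_pM2r ?invr_gt0 // lerD2l.
  rewrite mulr_ge0 //=; apply: le_trans qS; rewrite ler_wpM2l //.
- move=> d /andP[ad _]; rewrite add0r mul1r.
  have ez := expRN_le z0.
  have e0 := expR_gt0 (- z).
  have x0 : 0 <= 1 - p * (1 - expR (- z)) by have := p0; have := p1; nra.
  rewrite (_ : 1 - p + _ = 1 - p * (1 - expR (- z))); last by ring.
  rewrite exprAC; rewrite lerXn2r ?nnegrE ?exprn_ge0 ?expR_ge0 //.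
  apply: le_trans (one_sub_exp _ x0) _; rewrite ler_expR lerN2.
  have zz : 15 / 16 * z <= 1 - expR (- z) by nra.
  apply: (@le_trans _ _ (p * (15 / 16 * z) * ((1 - eps) * p * n%:R))); last first.
    apply: ler_pM => //; last by rewrite ler_pM2l.
      by apply: mulr_ge0; [exact: ltW | lra].
    exact: mulr_ge0 (mulr_ge0 (ltW e10) (ltW p0)) (ltW N0).
  (* The constant [675 / 1024] is [15 / 16 * 3 / 4 * 15 / 16], from [1 - expR (- z)], [z] and [k0].
     The other factors are at least [8 * (15 / 17)], so the coefficient of [ln n] exceeds [3]. *)
  have -> : p * (15 / 16 * z) * ((1 - eps) * p * n%:R) =
     ln n%:R * ((K%:R * p) * beta * (675 / 1024) * ((1 - eps) / (1 + eps))).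
    by rewrite /z /q /k0; field; rewrite !gt_eqF // addr_gt0.
  rewrite mulrC ler_wpM2l //.
  have ee : 15 / 17 <= (1 - eps) / (1 + eps).
    by rewrite ler_pdivlMr ?addr_gt0 //; have := eps1; have := eps0; lra.
  have kb : 8 <= K%:R * p * beta by have := Kp; have := p0; have := beta8; nra.
  move: ee kb; set Y := _ / (1 + eps); set X := K%:R * p * beta => ee kb.
  have : 8 * (15 / 17) <= X * Y by nra.
  lra.
Unshelve. all: by end_near. Qed.

(** Common core of the medium and large ranges: [half_chord] makes the bound affine in
    [(1 - 2 * q n) ^+ j], whose column average is [(1 - 2 * p * q n) ^+ #|S|]. *)
Lemma chord_bound n (v : 'I_n) (S : {set 'I_n}) (D' : R) :
  (forall d, typical n d -> q n <= pi_coef beta d <= 2^-1) ->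
  0 <= q n -> q n <= 2^-1 ->
  (forall d, typical n d ->
     (c + (1 - c) * expR (- (2 * p * q n * #|S|%:R))) ^+ d <= D') ->
  0 <= D' -> T v S <= D'.
Proof.
move=> range q0 q1 HD D0; have /andP[c0 c2] := c01; have c3 : 0 <= 1 - c by move: c2; lra.
apply: (@blocked_avg_bound R p beta K n v S (typical n) c (1 - c) (1 - 2 * q n)) => //.
- by rewrite !ltW.
- by rewrite ltW.
- by move: q1; lra.
- move=> d j /range/ratio/andP[x0 x1] _.
  set x := 1 - 2 * _ in x0 x1 *; split; first by rewrite addr_ge0 ?exprn_ge0.
  apply: le_trans (half_chord K (y := x ^+ j) _) _.
    have x2 : x <= 1 by move: x1 q0; lra.
    by rewrite exprn_ge0 //= exprn_ile1.
  rewrite lerD2l ler_wpM2l //.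
  by rewrite lerXn2r ?nnegrE //; lra.
- move=> d td; apply: le_trans (HD _ td).
  have x0 : 0 <= 1 - 2 * p * q n by have := p0; have := p1; nra.
  have e : 1 - p + p * (1 - 2 * q n) = 1 - 2 * p * q n by ring.
  rewrite e; apply: lerXn2r; rewrite ?nnegrE.
  - by rewrite addr_ge0 ?(ltW c0) // mulr_ge0 // exprn_ge0.
  - by rewrite addr_ge0 ?(ltW c0) // mulr_ge0 // expR_ge0.
  - by rewrite lerD2l ler_wpM2l // one_sub_exp.
Qed.

(** Half of the exponent [c1 * n] is kept; as [#|S| <= c1 ^+ 2 / 8 * n], the other half pays for
    [expR (- (4 / c1)) ^+ #|S|], a weight that controls the later sum over [S]. *)
Lemma medium_support : \forall n \near \oo%classic, forall (v : 'I_n) (S : {set 'I_n}),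
  6^-1 <= q n * #|S|%:R -> #|S|%:R <= c1 ^+ 2 / 8 * n%:R ->
  T v S <= expR (- (c1 / 2) * n%:R) * (c1 / 4) ^+ #|S|.
Proof.
have /andP[c0 c2] := c01; have c3 : 0 <= 1 - c by move: c2; lra.
near=> n => v S qS Sn.
have range : forall d, typical n d -> q n <= pi_coef beta d <= 2^-1.
  by near: n; exact: near_pi_coef_range.
have n2 : 2 <= n%:R :> R by near: n; exact: nbhs_infty_ger.
have N0 : 0 < n%:R :> R by lra.
have q0 : 0 <= q n by rewrite q_ge0 //; lra.
have q1 : q n <= 2^-1 by near: n; apply: near_q_le; rewrite invr_gt0.
apply: chord_bound => //; last by rewrite mulr_ge0 ?expR_ge0 // exprn_ge0 // divr_ge0 // ltW.
move=> d /andP[ad _].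
apply: (@le_trans _ _ (expR (- kap) ^+ d)).
  rewrite lerXn2r ?nnegrE ?expR_ge0 ?addr_ge0 ?mulr_ge0 ?expR_ge0 ?(ltW c0) //.
  apply: le_trans (expR_ge1Dx _).
  rewrite (_ : 1 + - kap = c + (1 - c) * expR (- (p / 3))); last by rewrite /kap; ring.
  rewrite lerD2l ler_wpM2l //.
  by rewrite ler_expR lerN2 -mulrA; have := p0; nra.
rewrite -expRM_natr.
have x4 : expR (- (4 / c1)) <= c1 / 4.
  have : 0 < 4 / c1 by rewrite divr_gt0.
  move=> h; rewrite expRN -[leRHS]invrK lef_pV2 ?posrE ?invr_gt0 ?expR_gt0 ?divr_gt0 //.
  by rewrite invf_div; apply: le_trans (expR_ge1Dx _); rewrite lerDr.
apply: (@le_trans _ _ (expR (- (c1 / 2) * n%:R) * expR (- (4 / c1)) ^+ #|S|)); last first.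
  by rewrite ler_wpM2l ?expR_ge0 // lerXn2r ?nnegrE ?expR_ge0 // divr_ge0 // ltW.
rewrite -expRM_natr -expRD ler_expR.
have h1 : 4 / c1 * #|S|%:R <= c1 / 2 * n%:R.
  rewrite mulrAC ler_pdivrMr //; lra.
have h2 : c1 * n%:R <= kap * d%:R.
  by rewrite /c1 -mulrA ler_pM2l.
lra.
Unshelve. all: by end_near. Qed.

(** Here [q n * #|S|] is at least of order [ln n], so the bias vanishes and an in-neighbour
    contributes nearly [c]. *)
Lemma large_support : \forall n \near \oo%classic, forall (v : 'I_n) (S : {set 'I_n}),
  c1 ^+ 2 / 8 * n%:R <= #|S|%:R ->
  T v S <= expR (- (ln 2 * (1 + p / 2)) * n%:R).
Proof.
have /andP[c0 c2] := c01; have c3 : 0 <= 1 - c by move: c2; lra.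
(* The tolerated relative bias. Its [3 / 8] and the [1 / 16] in [eps] fit because [(1 - p / 16) * (1
   + p) - 3 / 8 * p ^+ 2 >= 1 + p / 2] for [p] in [[0, 1]]. *)
pose eta : R := 3 * p * ln 2 / 8.
have ln2 : 0 < ln 2 :> R by rewrite ln_gt0 // ltr1n.
have eta0 : 0 < eta by rewrite /eta !mulr_gt0.
pose g : R := 2 * p * k0 * (c1 ^+ 2 / 8).
have g0 : 0 < g.
  by apply: mulr_gt0; [apply: mulr_gt0 k00; exact: mulr_gt0 | rewrite divr_gt0 // exprn_gt0].
near=> n => v S Sn.
have range : forall d, typical n d -> q n <= pi_coef beta d <= 2^-1.
  by near: n; exact: near_pi_coef_range.
have n2 : 2 <= n%:R :> R by near: n; exact: nbhs_infty_ger.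
have N0 : 0 < n%:R :> R by lra.
have q0 : 0 <= q n by rewrite q_ge0 //; lra.
have q1 : q n <= 2^-1 by near: n; apply: near_q_le; rewrite invr_gt0.
have lbig : - ln (c * eta) / g <= ln n%:R by near: n; exact: near_ln_ge.
apply: chord_bound => //.
move=> d /andP[ad _].
have cE : c = expR (- (K%:R * ln 2)) by rewrite /c exprVn expRN expRM_natl lnK ?posrE.
have ex : expR (- (2 * p * q n * #|S|%:R)) <= c * eta.
  rewrite -[leRHS]lnK ?posrE ?mulr_gt0 // ler_expR.
  apply: (@le_trans _ _ (- (g * ln n%:R))); last by move: lbig; rewrite ler_pdivrMr //; lra.
  rewrite lerN2 (_ : g * ln n%:R = 2 * p * q n * (c1 ^+ 2 / 8 * n%:R)); last first.
    by rewrite /g /q; field; rewrite gt_eqF.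
  by rewrite ler_wpM2l // mulr_ge0 // mulr_ge0 // ltW.
apply: (@le_trans _ _ (expR (- (K%:R * ln 2 - eta)) ^+ d)).
  rewrite lerXn2r ?nnegrE ?expR_ge0 ?addr_ge0 ?mulr_ge0 ?expR_ge0 ?(ltW c0) //.
  rewrite (_ : - (K%:R * ln 2 - eta) = - (K%:R * ln 2) + eta); last by ring.
  rewrite expRD -cE.
  apply: (@le_trans _ _ (c * (1 + eta))); last first.
    by rewrite ler_wpM2l ?(ltW c0) // expR_ge1Dx.
  have := expR_ge0 (- (2 * p * q n * #|S|%:R)); nra.
rewrite -expRM_natr ler_expR !mulNr lerN2.
have K1 : 1 <= K%:R :> R by rewrite ler1n.
have Keta : 0 <= K%:R * ln 2 - eta by rewrite /eta; have := p1; nra.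
apply: (@le_trans _ _ ((K%:R * ln 2 - eta) * ((1 - eps) * p * n%:R))); last by rewrite ler_wpM2l.
rewrite mulrA ler_pM2r //.
have -> : (K%:R * ln 2 - eta) * ((1 - eps) * p) =
   ln 2 * ((1 - eps) * (K%:R * p) - 3 / 8 * p * ((1 - eps) * p)).
  by rewrite /eta; ring.
rewrite ler_pM2l //.
have e1 : 0 <= 1 - eps by exact: ltW.
have := ler_wpM2l e1 Kp; rewrite /eps; have := p0; have := p1; nra.
Unshelve. all: by end_near. Qed.

(** Since [D] adds the bounds of the three ranges, it covers every [S]; its summands are summed
    separately and yield the three terms of [C]. *)
Lemma blocked_rate : exists C (D : nat -> nat -> R),
  \forall n \near \oo%classic,
  (forall (v : 'I_n) (S : {set 'I_n}),
    \sum_(E : digraph n) \sum_(X : coefs K n)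
     graph_weight p E * coef_weight beta E X *
     (if [forall u, ((1 - p / 16) * p * n%:R <= (indeg E u)%:R <= (1 + p / 16) * p * n%:R)]
      then (blocked E X v S)%:R else 0) <= D n #|S|) /\
  n%:R * \sum_(S : {set 'I_n} | S != finset.set0) D n #|S| <= C / n%:R.
Proof.
have ln2 : 0 < ln 2 :> R by rewrite ln_gt0 // ltr1n.
pose c2 : R := c1 / 4; pose c3 : R := ln 2 * (p / 2).
have c20 : 0 < c2 by rewrite divr_gt0.
have c30 : 0 < c3 by apply: mulr_gt0 => //; rewrite divr_gt0.
exists (2 + 2 / c2 ^+ 2 + 2 / c3 ^+ 2), D; near=> n; split.
  move=> v S; rewrite -/(T v S).
  have t1 : 0 <= expR (- (3 * ln n%:R)) ^+ #|S| :> R by rewrite exprn_ge0 ?expR_ge0.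
  have t2 : 0 <= expR (- (c1 / 2) * n%:R) * (c1 / 4) ^+ #|S|.
    by rewrite mulr_ge0 ?expR_ge0 // exprn_ge0 // ltW.
  have t3 := expR_ge0 (- (ln 2 * (1 + p / 2)) * n%:R).
  have [small|big] := leP (q n * #|S|%:R) 6^-1.
    have : T v S <= expR (- (3 * ln n%:R)) ^+ #|S|.
      by move: v S {t1 t2} small; near: n; exact: small_support.
    rewrite /D; lra.
  have [medium|large] := leP #|S|%:R (c1 ^+ 2 / 8 * n%:R).
    have : T v S <= expR (- (c1 / 2) * n%:R) * (c1 / 4) ^+ #|S|.
      by move/ltW in big; move: v S {t1 t2} big medium; near: n; exact: medium_support.
    rewrite /D; lra.
  have : T v S <= expR (- (ln 2 * (1 + p / 2)) * n%:R).
    by move/ltW in large; move: v S {t1 t2 big} large; near: n; exact: large_support.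
  rewrite /D; lra.
have n2 : 2 <= n%:R :> R by near: n; exact: nbhs_infty_ger.
have N0 : 0 < n%:R :> R by lra.
have n0 : (0 < n)%N by rewrite -(ltr_nat R).
rewrite !big_split /= 2!(mulrDr (n%:R : R)) 2!(mulrDl _ _ (n%:R^-1 : R)); apply: lerD; first apply: lerD.
(* With [x = n ^- 3] the sum is at most [expR (n ^- 2) - 1 <= 2 * n ^- 2]. *)
- apply: (@le_trans _ _ (n%:R * (2 * n%:R ^- 2))); last first.
    by rewrite le_eqVlt; apply/orP; left; apply/eqP; field; rewrite gt_eqF.
  rewrite ler_pM2l //; apply: le_trans (sum_pow_card_le _ (expR_ge0 _)) _.
  have -> : expR (- (3 * ln n%:R)) * n%:R = n%:R ^- 2 :> R.
    rewrite expRN (expRM_natl 3) lnK ?posrE //; field; rewrite gt_eqF //.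
  have m0 : 0 <= (n%:R : R) ^- 2 <= 2^-1.
    rewrite invr_ge0 exprn_ge0 //= lef_pV2 ?posrE ?exprn_gt0 //; nra.
  have := expR_le_quad m0; move: m0 => /andP[]; nra.
(* With the empty set added back, the sum of the powers is [(1 + c1 / 4) ^+ n <= expR (c1 / 4 * n)];
   half of the exponent survives as [c2]. *)
- apply: le_trans (natmul_exp_le c20 n0); rewrite ler_pM2l // -mulr_sumr.
  apply: (@le_trans _ _ (expR (- (c1 / 2) * n%:R) * (1 + c1 / 4) ^+ n)).
    rewrite ler_wpM2l ?expR_ge0 // -sum_pow_card [leRHS](bigID (fun S => S != finset.set0)) /=.
    by rewrite lerDl sumr_ge0 // => S _; rewrite exprn_ge0 // ltW.
  apply: (@le_trans _ _ (expR (- (c1 / 2) * n%:R) * expR (c1 / 4 * n%:R))).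
    rewrite ler_wpM2l ?expR_ge0 // expRM_natr lerXn2r ?nnegrE ?expR_ge0 ?expR_ge1Dx //.
    by rewrite addr_ge0 // ltW.
  by rewrite -expRD ler_expR /c2; lra.
(* The [2 ^+ n] sets use up [ln 2] of the exponent and leave [c3]. *)
- apply: le_trans (natmul_exp_le c30 n0); rewrite ler_pM2l //.
  set w := expR _; apply: (@le_trans _ _ (2 ^+ n * w)).
    have -> : 2 ^+ n * w = \sum_(S : {set 'I_n}) w.
      rewrite -[2]/(1 + 1) -sum_pow_card mulr_suml.
      by apply: eq_bigr => S _; rewrite expr1n mul1r.
    rewrite [leRHS](bigID (fun S => S != finset.set0)) /=.
    by rewrite lerDl sumr_ge0 // => S _; exact: expR_ge0.
  have -> : 2 ^+ n = expR (n%:R * ln 2) :> R by rewrite expRM_natl lnK ?posrE.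
  by rewrite -expRD ler_expR /c3; lra.
Unshelve. all: by end_near. Qed.

End Rates.

(** * Number of coded rounds, and the limit *)

(** Of the [ceil (1 / p) + 1] coded rounds, the first [ceil (1 / p)] contribute at least [1] and the
    last one gives the surplus [p]. *)
Lemma round_bound_ge (R : realType) (p : R) : 0 < p ->
  1 + p <= (round_bound p - 1)%:R * p.
Proof.
move=> p0; rewrite /round_bound addn2 subn1 /= -natr1 mulrDl mul1r lerD2r.
rewrite -ler_pdivrMr // mul1r natr_absz ger0_norm ?ceil_ge //.
by rewrite -(ler_int R) (le_trans _ (ceil_ge _)) // invr_ge0 ltW.
Qed.

Local Open Scope classical_set_scope.
Local Open Scope ring_scope.

Theorem theorem2 (R : realType) (p beta : R) :
  0 < p < 1 -> 8 < beta ->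
  (fun n : nat => prob_late p beta n) @ \oo --> 0.
Proof.
move=> p01 b8; have /andP[p0 p1] := p01.
have p01' : 0 <= p <= 1 by rewrite !ltW.
have b0 : 0 <= beta by lra.
have [C [D ratesD]] := blocked_rate p01 b8 (round_bound_ge p0).
pose c0 : R := p * (p / 16) ^+ 2 / 8.
have c00 : 0 < c0 by rewrite !(divr_gt0, mulr_gt0, exprn_gt0).
pose C0 : R := (expR 1 + 1) * (2 / c0 ^+ 2) + C.
have late0 n : 0 <= prob_late p beta n.
  rewrite /prob_late; apply: sumr_ge0 => E _; apply: sumr_ge0 => X _; case: ifP => // _.
  by apply: mulr_ge0; [exact: graph_weight_ge0 | exact: coef_weight_ge0].
apply/cvgrPdist_le => e e0; near=> n.
have n0 : (0 < n)%N by near: n; exact: nbhs_infty_gt.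
(* Both error terms are [O(1 / n)], so the comparison is with [C0 / n]. *)
rewrite sub0r normrN ger0_norm //; apply: (@le_trans _ _ (C0 / n%:R)); last first.
  rewrite ler_pdivrMr ?ltr0n // mulrC -ler_pdivrMr //.
  by near: n; exact: nbhs_infty_ger.
have [HD sumD] : (forall (v : 'I_n) (S : {set 'I_n}),
    \sum_(E : digraph n) \sum_(X : coefs (round_bound p - 1) n)
     graph_weight p E * coef_weight beta E X *
     (if [forall u, ((1 - p / 16) * p * n%:R <= (indeg E u)%:R <= (1 + p / 16) * p * n%:R)]
      then (blocked E X v S)%:R else 0) <= D n #|S|) /\
  n%:R * \sum_(S : {set 'I_n} | S != finset.set0) D n #|S| <= C / n%:R.
  by near: n.
apply: le_trans (prob_late_le (P := fun d =>
  (1 - p / 16) * p * n%:R <= d%:R <= (1 + p / 16) * p * n%:R)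
  (D := fun S => D n #|S|) p01' b0 (fun S v _ => HD v S)) _.
rewrite /C0 [leRHS]mulrDl; apply: lerD => //.
apply: (@le_trans _ _ (\sum_(v : 'I_n) (expR 1 + 1) * expR (- c0 * n%:R))).
  apply: ler_sum => v _; apply: indeg_concentration => //.
  by apply/andP; split; lra.
rewrite sumr_const card_ord -[leLHS]mulr_natl [leLHS]mulrCA -[leRHS]mulrA ler_wpM2l ?addr_ge0 ?expR_ge0 //.
exact: natmul_exp_le.
Unshelve. all: by end_near. Qed.
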